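(* Fix a seed graph $S$, a positive integer $t_{\star}$ with $t_{\star} > |S|$, and a Markov sequential attachment rule $\mathcal{G}$. Suppose that there are graphs $G$ and $G'$ such that $|G| = |G'| = t_{\star}$, $G, G' \in \mathrm{Range}(\mathcal{G}, S)$, and $$\lim_{n \to \infty} \mathrm{TV}\left( \mathcal{G}(n, G), \mathcal{G}(n, G') \right) > 0.$$ Then $$\lim_{n \to \infty} \mathrm{TV}\left( \mathcal{CG}(n, t_{\star}, S), \mathcal{G}(n, S)^{\otimes 2} \right) > 0.$$
   Context: Graphs are finite and unlabeled (two isomorphic graphs are regarded as equal); $|G|$ denotes the number of vertices of $G$. A model of randomly growing graphs is given by a seed graph $S$ and a (probabilistic) sequential attachment rule $\mathcal{G}$: the random sequence $\{G_t\}_{t \geq |S|}$ satisfies $G_{|S|} = S$, and given $G_t$, the graph $G_{t+1}$ is formed from $G_t$ by adding a single new vertex that is attached to some of the vertices of $G_t$, chosen at random according to $\mathcal{G}$. The rule is Markov if for every $t \geq |S|$, $\mathbb{P}(G_{t+1} = G \mid G_{|S|}, \ldots, G_t) = \mathbb{P}(G_{t+1} = G \mid G_t)$; thus the growth is described by a transition kernel, which is the same whatever the seed. $\mathcal{G}(n, S)$ denotes the law of $G_n$ started from seed $S$ (similarly $\mathcal{G}(n,H)$ for a seed $H$, $n \geq |H|$). $\mathrm{Range}(\mathcal{G}, S)$ is the set of graphs $G$ for which there is an $n$ such that $\mathbb{P}(G_n = G) > 0$ when $G_n \sim \mathcal{G}(n,S)$. For an integer $t_{\star} \geq |S|$ and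 $n\ge t_\star$, $\mathcal{CG}(n, t_{\star}, S)$ denotes the law of the pair $(G_n^1, G_n^2)$, where: for $|S| \leq t \leq t_{\star}$, $G_t^1 = G_t^2 =: G_t$ with $\{G_t\}$ grown from seed $S$ according to $\mathcal{G}$; and, conditionally on $G_{t_{\star}}$, the sequences $\{G_t^1\}_{t \geq t_{\star}}$ and $\{G_t^2\}_{t \geq t_{\star}}$ are independent, both started from $G_{t_{\star}}$ and growing according to $\mathcal{G}$. $\mathcal{G}(n,S)^{\otimes 2}$ is the law of two independent samples of $\mathcal{G}(n,S)$. $\mathrm{TV}(P,Q) = \sup_A |P(A) - Q(A)|$ is total variation distance. The total variation distances above are non-increasing in $n$, so the limits exist. *)

(* Defs.v *)
From HB Require Import structures.
From mathcomp Require Import all_boot all_order all_algebra all_fingroup.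
From mathcomp Require Import all_classical all_reals all_analysis.
From mathcomp Require Import generic_quotient.

Set Implicit Arguments.
Unset Strict Implicit.
Unset Printing Implicit Defensive.

Import Order.TTheory GRing.Theory Num.Theory.
Import numFieldNormedType.Exports.

Local Open Scope quotient_scope.
Local Open Scope ring_scope.

Definition is_simple n (e : {ffun 'I_n * 'I_n -> bool}) : bool :=
  [forall i, ~~ e (i, i)] && [forall i, forall j, e (i, j) == e (j, i)].

Definition lgraph (n : nat) : Type :=
  {e : {ffun 'I_n * 'I_n -> bool} | is_simple e}.

Definition adj n (g : lgraph n) : rel 'I_n := fun i j => val g (i, j).

Definition liso n : rel (lgraph n) := fun g h =>
  [exists s : 'S_n, forall i, forall j, adj g i j == adj h (s i) (s j)].

Lemma lisoP n (g h : lgraph n) :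
  reflect (exists s : 'S_n, forall i j, adj g i j = adj h (s i) (s j))
          (liso g h).
Proof.
apply: (iffP existsP) => -[s gh]; exists s.
  by move=> i j; apply/eqP; move/forallP/(_ i)/forallP/(_ j): gh.
by apply/forallP => i; apply/forallP => j; apply/eqP.
Qed.

Lemma liso_refl n : reflexive (@liso n).
Proof. by move=> g; apply/lisoP; exists 1%g => i j; rewrite !perm1. Qed.

Lemma liso_sym n : symmetric (@liso n).
Proof.
suff imp g h : @liso n g h -> liso h g by move=> g h; apply/idP/idP; apply: imp.
move=> /lisoP[s gh]; apply/lisoP; exists s^-1%g => i j.
by rewrite gh !permKV.
Qed.

Lemma liso_trans n : transitive (@liso n).
Proof.
move=> h g k /lisoP[s gh] /lisoP[t hk]; apply/lisoP; exists (s * t)%g => i j.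
by rewrite gh hk !permM.
Qed.

Canonical liso_equiv n :=
  EquivRel (@liso n) (@liso_refl n) (@liso_sym n) (@liso_trans n).

Definition ugraph (n : nat) : Type := {eq_quot @liso_equiv n}.

HB.instance Definition _ n := Choice.copy (ugraph n) {eq_quot liso_equiv n}.
HB.instance Definition _ n :=
  EqQuotient.copy (ugraph n) {eq_quot liso_equiv n}.
HB.instance Definition _ n : isCountable (ugraph n) :=
  CanIsCountable (@reprK _ (ugraph n)).
HB.instance Definition _ n : fintype.isFinite (ugraph n) :=
  CanIsFinite (@reprK _ (ugraph n)).

Definition graph : Type := {n : nat & ugraph n}.

Definition nvert (G : graph) : nat := tag G.

(** The new vertex is [ord_max]; its neighbourhood is an arbitrary set,
    possibly empty. *)
Definition one_vertex_ext n (G : ugraph n) (H : ugraph n.+1) : Prop :=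
  exists (g : lgraph n) (h : lgraph n.+1),
    [/\ G = \pi_(ugraph n) g, H = \pi_(ugraph n.+1) h &
        forall i j, adj h (lift ord_max i) (lift ord_max j) = adj g i j].

(** Laws on finite types are given by their mass functions.  Being Markov, the
    rule is a transition kernel, independent of the seed. *)

Record markov_rule (R : realType) := MarkovRule {
  trans :> forall n, ugraph n -> ugraph n.+1 -> R ;
  trans_ge0 : forall n (G : ugraph n) (H : ugraph n.+1), 0 <= trans G H ;
  trans_sum1 : forall n (G : ugraph n), \sum_(H : ugraph n.+1) trans G H = 1 ;
  trans_ext : forall n (G : ugraph n) (H : ugraph n.+1),
    0 < trans G H -> one_vertex_ext G H }.

Section Laws.
Variable R : realType.

Definition dirac_at (S : graph) n : ugraph n -> R :=
  fun H => (Tagged ugraph H == S)%:R.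

(** The mixture: sample [x] from [P], then sample from [k x]. *)
Definition bind (T U : finType) (P : T -> R) (k : T -> U -> R) : U -> R :=
  fun y => \sum_(x : T) P x * k x y.

Definition indep (T U : finType) (P : T -> R) (Q : U -> R) : T * U -> R :=
  fun z => P z.1 * Q z.2.

Definition prob (T : finType) (P : T -> R) (A : {set T}) : R :=
  \sum_(x in A) P x.

Definition TV (T : finType) (P Q : T -> R) : R :=
  sup (range (fun A : {set T} => `|prob P A - prob Q A|)).

Variable K : markov_rule R.

(** The law of [G_n] started from [S]; for [n < nvert S], where the process is
    not defined, the mass function is identically zero. *)
Fixpoint law (S : graph) (n : nat) : ugraph n -> R :=
  match n with
  | 0 => dirac_at S (n := 0)
  | m.+1 => if (m.+1 <= nvert S)%N then dirac_at S (n := m.+1)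
            else bind (law S (n := m)) (trans K (n := m))
  end.

Definition growth_range (S : graph) : set graph :=
  [set G | exists n (H : ugraph n), G = Tagged ugraph H /\ 0 < law S H]%classic.

(** The law of [(G_n^1, G_n^2)] for [nvert S <= t <= n]: grow a common
    [G_t] from [S], then two conditionally independent copies from [G_t]. *)
Definition coupled_law (n t : nat) (S : graph) : ugraph n * ugraph n -> R :=
  bind (law S (n := t))
       (fun H => let G := Tagged ugraph H in
                 indep (law G (n := n)) (law G (n := n))).

End Laws.

Arguments law {R} K S n _.
Arguments coupled_law {R} K n t S _.
Arguments growth_range {R} K S.

Lemma law_ge0 (R : realType) (K : markov_rule R) S n (H : ugraph n) :
  0 <= law K S n H.
Proof.
elim: n H => [|n IH] H /=; first exact: ler0n.
by case: ifP => _; [exact: ler0n | apply: sumr_ge0 => G _; rewrite mulr_ge0 ?trans_ge0].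
Qed.

Lemma law_sum1 (R : realType) (K : markov_rule R) S n :
  (nvert S <= n)%N -> \sum_(H : ugraph n) law K S n H = 1.
Proof.
have dir1 (G : graph) : \sum_(H : ugraph (nvert G)) dirac_at R G H = 1.
  case: G => m G; rewrite (bigD1 G) //= big1 ?addr0 /dirac_at ?eqxx // => H HG.
  by rewrite eq_Tagged /= (negPf HG).
elim: n => [|n IH]; first by rewrite leqn0 => /eqP S0; rewrite -(dir1 S) S0.
rewrite leq_eqVlt => /orP[/eqP Sn|Sn] /=.
  have le_Sn : (n.+1 <= nvert S)%N by rewrite Sn.
  by rewrite le_Sn; move: (dir1 S); rewrite Sn.
rewrite leqNgt Sn /= /bind exchange_big /= -[RHS]IH //.
by apply: eq_bigr => G _; rewrite -mulr_sumr trans_sum1 mulr1.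
Qed.

(* Main.v *)
Require Import Defs.
From mathcomp Require Import all_boot all_order all_algebra.
From mathcomp Require Import all_classical all_reals all_analysis.
From mathcomp Require Import ring lra.

Import Order.TTheory GRing.Theory Num.Theory.
Import numFieldNormedType.Exports.
Local Open Scope ring_scope.

(** Write [p] for the law of [G_tstar] grown from [S] and [P_H] for the law at
    time [n] started from [H].  By the Markov property the law of [G_n] is the
    mixture of the [P_H] with weights [p H] ([law_restart]), while the coupled
    law is the mixture of the products of [P_H] with itself.  On a square event
    [A x A] these two pair laws therefore differ by
      [\sum_H p H * P_H A ^+ 2 - (\sum_H p H * P_H A) ^+ 2],
    the variance of [P_H A] when [H] is drawn from [p]: two copies sharing
    their past are positively correlated.  This variance is at least
    [p G * p G' * (P_G A - P_G' A) ^+ 2] ([weighted_var_ge]), and taking the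
    supremum over [A] gives
      [TV (coupled) (independent) >= p G * p G' * TV P_G P_G' ^+ 2]
    at every time [n >= tstar] ([TV_sq_le_TV_mixture]).  The weights [p G] and
    [p G'] do not depend on [n], and they are positive because [G] and [G'] are
    reachable from [S].

    It remains to let [n] grow.  One growth step applies the same stochastic
    kernel to both laws of each pair, so neither distance can increase from
    [tstar] on ([TV_bind]).  Hence both limits exist, the first bounds its
    terms from below, and the inequality passes to the limit. *)

(** * Total variation distance and data processing *)

Lemma le_prob_diff_TV (R : realType) (T : finType) (P Q : T -> R)
    (A : {set T}) :
  `|prob P A - prob Q A| <= TV P Q.
Proof.
apply: ub_le_sup; last by exists A.
exists (\sum_(x : T) `|P x - Q x|) => _ [B _ <-].
rewrite /prob -sumrB; apply: le_trans (ler_norm_sum _ _ _) _.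
by rewrite [leRHS](bigID (mem B)) /= lerDl sumr_ge0.
Qed.

Lemma TV_le (R : realType) (T : finType) (P Q : T -> R) (c : R) :
  (forall A : {set T}, `|prob P A - prob Q A| <= c) -> TV P Q <= c.
Proof.
move=> dc; apply: ge_sup => [|_ [A _ <-]]; last exact: dc.
by exists `|prob P finset.set0 - prob Q finset.set0|; exists finset.set0.
Qed.

Lemma TV_ge0 (R : realType) (T : finType) (P Q : T -> R) : 0 <= TV P Q.
Proof. exact: le_trans (normr_ge0 _) (le_prob_diff_TV R T P Q finset.set0). Qed.

Lemma TV_sym (R : realType) (T : finType) (P Q : T -> R) : TV P Q = TV Q P.
Proof.
by apply/le_anti/andP; split; apply: TV_le => A; rewrite distrC le_prob_diff_TV.
Qed.

(** Among weights valued in [0, 1], the sum is largest for the indicator of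
    the event where [P] dominates [Q]; this extends the defining inequality of
    [TV] from events to randomized tests. *)
Lemma sum_diff_le_TV (R : realType) (T : finType) (P Q f : T -> R) :
  (forall x, 0 <= f x <= 1) -> \sum_x (P x - Q x) * f x <= TV P Q.
Proof.
move=> f01; pose B := [set x | Q x <= P x]%SET.
apply: le_trans (le_prob_diff_TV R T P Q B).
apply: le_trans (ler_norm _); rewrite /prob -sumrB.
rewrite (bigID (mem B)) /= -[leRHS]addr0; apply: lerD.
  apply: ler_sum => x; rewrite inE => PQ; have /andP[_ f1] := f01 x.
  by rewrite ler_piMr // subr_ge0.
apply: sumr_le0 => x; rewrite inE -ltNge => PQ; have /andP[f0 _] := f01 x.
by rewrite mulr_le0_ge0 // subr_le0 ltW.
Qed.

Lemma prob_bind (R : realType) (T U : finType) (P : T -> R) (k : T -> U -> R)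
    (A : {set U}) :
  prob (bind P k) A = \sum_x P x * prob (k x) A.
Proof.
rewrite /prob /bind exchange_big /=.
by apply: eq_bigr => x _; rewrite mulr_sumr.
Qed.

(** Data processing inequality: an event after the step of the kernel is a
    randomized test before it. *)
Lemma TV_bind (R : realType) (T U : finType) (P Q : T -> R)
    (k : T -> U -> R) :
  (forall x y, 0 <= k x y) -> (forall x, \sum_y k x y = 1) ->
  TV (bind P k) (bind Q k) <= TV P Q.
Proof.
move=> k0 k1.
have kA01 A x : 0 <= prob (k x) A <= 1.
  rewrite sumr_ge0 //= -(k1 x) [leRHS](bigID (mem A)) /= lerDl.
  by rewrite sumr_ge0.
have diffE (P' Q' : T -> R) A : prob (bind P' k) A - prob (bind Q' k) A =
    \sum_x (P' x - Q' x) * prob (k x) A.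
  by rewrite !prob_bind -sumrB; apply: eq_bigr => x _; rewrite mulrBl.
apply: TV_le => A; rewrite ler_norml lerNl opprB !diffE.
apply/andP; split; last exact: sum_diff_le_TV.
by rewrite TV_sym; exact: sum_diff_le_TV.
Qed.

(** * Mixtures and products *)

Lemma bind_bind (R : realType) (T U V : finType) (P : T -> R)
    (k : T -> U -> R) (l : U -> V -> R) :
  bind (bind P k) l = bind P (fun x => bind (k x) l).
Proof.
apply/funext => z; rewrite /bind.
under eq_bigr do rewrite mulr_suml.
rewrite exchange_big; apply: eq_bigr => x _ /=; rewrite mulr_sumr.
by apply: eq_bigr => y _; rewrite mulrA.
Qed.

Lemma sum_prod (R : realType) (T U : finType) (f : T -> R) (g : U -> R) :
  \sum_(z : T * U) f z.1 * g z.2 = (\sum_x f x) * (\sum_y g y).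
Proof.
rewrite mulr_suml -(pair_bigA _ (fun x y => f x * g y)) /=.
by apply: eq_bigr => x _; rewrite mulr_sumr.
Qed.

(** Running two kernels independently is one kernel on pairs; this makes
    [TV_bind] applicable to laws of pairs. *)
Lemma indep_bind (R : realType) (T T' U U' : finType) (P : T -> R)
    (P' : T' -> R) (k : T -> U -> R) (k' : T' -> U' -> R) :
  indep (bind P k) (bind P' k') =
  bind (indep P P') (fun z => indep (k z.1) (k' z.2)).
Proof.
apply/funext => -[y y']; rewrite /indep /bind /=.
rewrite -(sum_prod R T T' (fun x => P x * k x y) (fun x' => P' x' * k' x' y')).
by apply: eq_bigr => z _; rewrite mulrACA.
Qed.

Lemma prob_indep_setX (R : realType) (T U : finType) (P : T -> R) (Q : U -> R)
    (A : {set T}) (B : {set U}) :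
  prob (indep P Q) (finset.setX A B) = prob P A * prob Q B.
Proof.
rewrite /prob [X in X * _]big_mkcond [X in _ * X]big_mkcond -sum_prod.
rewrite big_mkcond.
apply: eq_bigr => -[x y] _; rewrite finset.in_setX /indep /=.
by case: (x \in A); case: (y \in B); rewrite ?mulr0 ?mul0r.
Qed.

(** * A variance bound for the shared-past coupling *)

(** The variance is half the mean of [(a z - a z') ^+ 2] over independent [z]
    and [z'] drawn from [p]; for [x != y], the left-hand side is what the pairs
    [(x, y)] and [(y, x)] contribute to it. *)
Lemma weighted_var_ge (R : realType) (T : finType) (p a : T -> R) (x y : T) :
  (forall z, 0 <= p z) -> \sum_z p z = 1 ->
  p x * p y * (a x - a y) ^+ 2 <=
  \sum_z p z * a z ^+ 2 - (\sum_z p z * a z) ^+ 2.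
Proof.
move=> p0 p1; set m := \sum_z p z * a z.
(* [m] is made opaque so that [mulr_sumr] does not see through it. *)
have mE : m = \sum_z p z * a z by [].
clearbody m.
have varE : \sum_z p z * a z ^+ 2 - m ^+ 2 = \sum_z p z * (a z - m) ^+ 2.
  (* Only the middle term has one factor [m] to be expanded as a sum, so that
     all three terms become sums over the same index. *)
  transitivity (\sum_z p z * a z ^+ 2 - 2 * m * m + m ^+ 2 * \sum_z p z).
    by rewrite p1; ring.
  rewrite {2}mE !mulr_sumr -sumrB -big_split /=.
  by apply: eq_bigr => z _; ring.
have sq0 z : 0 <= p z * (a z - m) ^+ 2 by rewrite mulr_ge0 ?sqr_ge0.
rewrite {}varE; have [->|xy] := eqVneq x y.
  by rewrite subrr expr0n mulr0 sumr_ge0.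
have pxy : p x + p y <= 1.
  rewrite -p1 (bigD1 x) //= (bigD1 y) 1?eq_sym //= addrA lerDl.
  by rewrite sumr_ge0.
rewrite (bigD1 x) //= (bigD1 y) 1?eq_sym //= addrA.
apply: (@le_trans _ _ (p x * (a x - m) ^+ 2 + p y * (a y - m) ^+ 2)); last first.
  by rewrite lerDl sumr_ge0.
have := p0 x; have := p0 y; move: (p x) (p y) pxy => q r qr r0 q0.
(* For [q + r = 1] the excess over the claimed bound is the square of the
   weighted sum of the two deviations; the missing mass [1 - q - r] only adds a
   nonnegative term. *)
rewrite -subr_ge0.
have -> : q * (a x - m) ^+ 2 + r * (a y - m) ^+ 2 - q * r * (a x - a y) ^+ 2 =
  (1 - q - r) * (q * (a x - m) ^+ 2 + r * (a y - m) ^+ 2) +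
  (q * (a x - m) + r * (a y - m)) ^+ 2 by ring.
rewrite addr_ge0 ?sqr_ge0 // mulr_ge0 //; first by lra.
by rewrite addr_ge0 // mulr_ge0 // sqr_ge0.
Qed.

(** The square event [A x A] turns the gap between sharing the hidden state
    [z] and resampling it into the variance of [prob (k z) A]. *)
Lemma prob_diff_sq_le_TV_mixture (R : realType) (T U : finType) (p : T -> R)
    (k : T -> U -> R) (x y : T) (A : {set U}) :
  (forall z, 0 <= p z) -> \sum_z p z = 1 ->
  p x * p y * (prob (k x) A - prob (k y) A) ^+ 2 <=
  TV (bind p (fun z => indep (k z) (k z))) (indep (bind p k) (bind p k)).
Proof.
move=> p0 p1; apply: le_trans (le_prob_diff_TV _ _ _ _ (finset.setX A A)).
apply: le_trans (ler_norm _); rewrite prob_bind prob_indep_setX prob_bind.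
under [X in _ <= X - _]eq_bigr do rewrite prob_indep_setX -expr2.
by rewrite -expr2; apply: (weighted_var_ge R T p (fun z => prob (k z) A)).
Qed.

Lemma TV_sq_le_TV_mixture (R : realType) (T U : finType) (p : T -> R)
    (k : T -> U -> R) (x y : T) :
  (forall z, 0 <= p z) -> \sum_z p z = 1 -> 0 < p x -> 0 < p y ->
  p x * p y * TV (k x) (k y) ^+ 2 <=
  TV (bind p (fun z => indep (k z) (k z))) (indep (bind p k) (bind p k)).
Proof.
move=> p0 p1 px py; set v := TV _ (indep _ _).
have pxy : 0 < p x * p y by rewrite mulr_gt0.
have v0 : 0 <= v / (p x * p y) by rewrite divr_ge0 ?TV_ge0 // ltW.
(* [TV] is a supremum of unsquared differences, so the bound is brought to the
   form [TV (k x) (k y) <= c] before [TV_le] is used. *)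
rewrite mulrC -ler_pdivlMr // -[leRHS]sqr_sqrtr //.
rewrite ler_sqr ?nnegrE ?TV_ge0 ?sqrtr_ge0 //; apply: TV_le => A.
rewrite -sqrtr_sqr ler_sqrt // ler_pdivlMr // mulrC.
exact: prob_diff_sq_le_TV_mixture.
Qed.

(** * The growth process *)

Lemma law_nvert (R : realType) (K : markov_rule R) t (H : ugraph t) :
  law K (Tagged ugraph H) t = @dirac_at R (Tagged ugraph H) t.
Proof. by case: t H => [|t] H //=; rewrite leqnn. Qed.

Lemma law_step (R : realType) (K : markov_rule R) (G : graph) n :
  (nvert G <= n)%N -> law K G n.+1 = bind (law K G n) (@trans R K n).
Proof. by move=> Gn; rewrite /= ltnNge Gn. Qed.

Lemma bind_dirac_at (R : realType) t (P : ugraph t -> R) :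
  bind P (fun H => @dirac_at R (Tagged ugraph H) t) = P.
Proof.
apply/funext => H; rewrite /bind (bigD1 H) //= /dirac_at eqxx mulr1.
rewrite big1 ?addr0 // => G GH.
by rewrite eq_Tagged /= eq_sym (negPf GH) mulr0.
Qed.

(** The Chapman-Kolmogorov identity, i.e. the Markov property at time [t]. *)
Lemma law_restart (R : realType) (K : markov_rule R) (S : graph) t n :
  (nvert S <= t)%N -> (t <= n)%N ->
  law K S n = bind (law K S t) (fun H => law K (Tagged ugraph H) n).
Proof.
move=> St; elim: n => [|n IH].
  rewrite leqn0 => /eqP t0; subst t; rewrite -[LHS](bind_dirac_at R 0).
  by congr bind; apply/funext => H; rewrite law_nvert.
rewrite leq_eqVlt => /orP[/eqP tn|].
  subst t; rewrite -[LHS](bind_dirac_at R n.+1).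
  by congr bind; apply/funext => H; rewrite law_nvert.
rewrite ltnS => tn; rewrite law_step ?(leq_trans St) // IH // bind_bind.
by congr bind; apply/funext => H; rewrite law_step.
Qed.

Lemma coupled_law_step (R : realType) (K : markov_rule R) (S : graph) t n :
  (t <= n)%N ->
  coupled_law K n.+1 t S =
  bind (coupled_law K n t S) (fun z => indep (trans K z.1) (trans K z.2)).
Proof.
move=> tn; rewrite /coupled_law bind_bind; congr bind.
by apply/funext => H; rewrite law_step // indep_bind.
Qed.

Lemma TV_law_step (R : realType) (K : markov_rule R) (G G' : graph) n :
  (nvert G <= n)%N -> (nvert G' <= n)%N ->
  TV (law K G n.+1) (law K G' n.+1) <= TV (law K G n) (law K G' n).
Proof.
move=> Gn G'n; rewrite !law_step //.
by apply: TV_bind => [*|*]; [exact: trans_ge0 | exact: trans_sum1].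
Qed.

Lemma TV_coupled_law_step (R : realType) (K : markov_rule R) (S : graph) t n :
  (nvert S <= n)%N -> (t <= n)%N ->
  TV (coupled_law K n.+1 t S) (indep (law K S n.+1) (law K S n.+1)) <=
  TV (coupled_law K n t S) (indep (law K S n) (law K S n)).
Proof.
move=> Sn tn; rewrite coupled_law_step // law_step // indep_bind.
apply: TV_bind => [z w|z]; first by rewrite mulr_ge0 ?trans_ge0.
by rewrite sum_prod !trans_sum1 mulr1.
Qed.

(** * Passage to the limit *)

(** The threshold [t] is needed because a law is zero before the time of its
    seed, so that the distances decrease only from time [tstar] on. *)
Lemma eventually_nonincreasing_cvg (R : realType) (u : nat -> R) t :
  (forall n, 0 <= u n) -> (forall n, (t <= n)%N -> u n.+1 <= u n) ->
  cvgn u /\ forall n, (t <= n)%N -> limn u <= u n.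
Proof.
move=> u0 u_step; pose v n := u (n + t)%N.
have v_noninc : {homo v : n m / (n <= m)%N >-> m <= n}.
  apply: homo_leq => [//||n]; first by move=> y x z; move/[swap]; exact: le_trans.
  by apply: u_step; exact: leq_addl.
have v_cvg : cvgn v.
  by apply: nonincreasing_is_cvgn => //; exists 0 => _ [n _ <-]; exact: u0.
have u_lim : (u @ \oo --> limn v)%classic by rewrite -(cvg_shiftn t).
split=> [|n tn]; first by apply/cvg_ex; exists (limn v).
rewrite (cvg_lim _ u_lim) //.
have := nonincreasing_cvgn_ge v_noninc v_cvg (n - t)%N.
by rewrite /v subnK.
Qed.

Theorem theorem1p1 (R : realType) (S : graph) (tstar : nat)
    (K : markov_rule R) :
  (nvert S < tstar)%N ->
  (exists G G' : graph,
     [/\ nvert G = tstar, nvert G' = tstar,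
         growth_range K S G, growth_range K S G' &
         0 < limn (fun n => TV (law K G n) (law K G' n))]) ->
  0 < limn (fun n => TV (coupled_law K n tstar S)
                        (indep (law K S n) (law K S n))).
Proof.
move=> St [G [G' [Gt G't [n [H [GH pH]]] [m [H' [GH' pH']]]]]].
subst G G'; rewrite /nvert /= in Gt G't; subst n m.
set u := fun n => TV (law K _ n) _; set v := fun n => TV _ (indep _ _) => l_gt0.
have [_ u_ge] : cvgn u /\ forall n, (tstar <= n)%N -> limn u <= u n.
  apply: eventually_nonincreasing_cvg => n; first exact: TV_ge0.
  by move=> tn; apply: TV_law_step.
have [v_cvg _] : cvgn v /\ forall n, (tstar <= n)%N -> limn v <= v n.
  apply: eventually_nonincreasing_cvg => n; first exact: TV_ge0.
  by move=> tn; apply: TV_coupled_law_step => //; exact: leq_trans (ltnW St) tn.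
apply: (@lt_le_trans _ _ (law K S tstar H * law K S tstar H' * limn u ^+ 2)).
  by rewrite !mulr_gt0 ?exprn_gt0.
apply: limr_ge => //; exists tstar => // n /= tn.
apply: (@le_trans _ _ (law K S tstar H * law K S tstar H' * u n ^+ 2)).
  have un := u_ge n tn.
  by rewrite ler_wpM2l ?mulr_ge0 ?law_ge0 // lerXn2r // nnegrE ?TV_ge0 // ltW.
rewrite /v (@law_restart _ _ _ tstar n) ?(ltnW St) //.
apply: (TV_sq_le_TV_mixture R _ _ (law K S tstar)
         (fun G => law K (Tagged ugraph G) n)) => //.
  by move=> G; exact: law_ge0.
exact/law_sum1/ltnW.
Qed.
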